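(* Let $(\mathcal C,\alpha)$ be a grading category with the unitors of $\mathrm{Mod}^{\mathcal C}$ chosen to be the typical ones, $A$ a $\mathcal C$-graded algebra and $M$ a $\mathcal C$-graded $(A,A)$-bimodule. Then $\mathsf{HH}^0(A;M)=M_{\mathcal C}^A$, the module of invariants. In particular, when $M=A$, $\mathsf{HH}^0(A)=Z^{\mathcal C}(A)$.
   Context: Let $\Bbbk$ be a commutative unital ring with unit group $\Bbbk^\times$ and $\mathcal C$ a small category. A grading category $(\mathcal C,\alpha)$: $\alpha$ assigns to each composable triple $(f_1,f_2,f_3)$ (so $f_3\circ f_2\circ f_1$ is defined) an element of $\Bbbk^\times$ such that for all composable $(f_1,f_2,f_3,f_4)$: $\alpha(f_1,f_2,f_3)\,\alpha(f_1,f_2,f_4\circ f_3)^{-1}\alpha(f_1,f_3\circ f_2,f_4)\,\alpha(f_2\circ f_1,f_3,f_4)^{-1}\alpha(f_2,f_3,f_4)=1$. A $\mathcal C$-graded module is a $\Bbbk$-module $M=\bigoplus_{g\in\mathrm{Mor}(\mathcal C)}M_g$; write $|x|=g$ for $x\in M_g$. Graded maps are $\Bbbk$-linear and preserve each $M_g$. $(M\otimes N)_g=\bigoplus_{g=g_2\circ g_1}M_{g_1}\otimes_\Bbbk N_{g_2}$ (products of elements with non-composable degrees are zero). Typical unitor constants: for $g:X\to Y$, $\mathcal L(\mathrm{Id}_X,g)=\alpha(\mathrm{Id}_X,\mathrm{Id}_X,g)^{-1}$, $\mathcal R(g,\mathrm{Id}_Y)=\alpha(g,\mathrm{Id}_Y,\mathrm{Id}_Y)$.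 A $\mathcal C$-graded algebra is a $\mathcal C$-graded module $A$ with a graded $\Bbbk$-linear $\mu:A\otimes A\to A$ and elements $1_X\in A_{\mathrm{Id}_X}$ with, for homogeneous elements, $\mu(\mu(x,y),z)=\alpha(|x|,|y|,|z|)\mu(x,\mu(y,z))$, $\mu(1_X,x)=\mathcal L(\mathrm{Id}_X,|x|)x$, $\mu(x,1_Y)=\mathcal R(|x|,\mathrm{Id}_Y)x$ if $|x|:X\to Y$. A $\mathcal C$-graded $(A,A)$-bimodule is a $\mathcal C$-graded module $M$ with graded maps $\rho_L:A\otimes M\to M$, $\rho_R:M\otimes A\to M$ such that $\rho_L(\mu(a,a'),m)=\alpha(|a|,|a'|,|m|)\rho_L(a,\rho_L(a',m))$, $\rho_R(\rho_R(m,b),b')=\alpha(|m|,|b|,|b'|)\rho_R(m,\mu(b,b'))$, $\rho_R(\rho_L(a,m),b)=\alpha(|a|,|m|,|b|)\rho_L(a,\rho_R(m,b))$, $\rho_L(1_X,m)=\mathcal L(\mathrm{Id}_X,|m|)m$, $\rho_R(m,1_Y)=\mathcal R(|m|,\mathrm{Id}_Y)m$ for $|m|:X\to Y$; $\mathrm{Bim}(A,A)^{\mathcal C}$ is the category of these with graded maps commuting with the actions. $A^{\otimes n+2}$ (parenthesized to the left) is such a bimodule via $\rho_L(a,a_0\otimes\cdots\otimes a_{n+1})=\prod_{i=1}^{n+1}\alpha(|a|,|a_{i-1}|\circ\cdots\circ|a_0|,|a_i|)^{-1}\mu(a,a_0)\otimes\cdots\otimes a_{n+1}$ and $\rho_R(a_0\otimes\cdots\otimes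 a_{n+1},a)=\alpha(|a_n|\circ\cdots\circ|a_0|,|a_{n+1}|,|a|)\,a_0\otimes\cdots\otimes\mu(a_{n+1},a)$. $\mathsf{HH}^k(A;M)$ is the $k$th cohomology of the cochain complex $\mathrm{Hom}_{\mathrm{Bim}(A,A)^{\mathcal C}}(A^{\otimes k+2},M)$, $k\ge0$, with differential precomposition with $\partial(a_0\otimes\cdots\otimes a_{n+1})=\sum_{i=0}^n(-1)^i\alpha(|a_{i-1}|\circ\cdots\circ|a_0|,|a_i|,|a_{i+1}|)\,a_0\otimes\cdots\otimes\mu(a_i,a_{i+1})\otimes\cdots\otimes a_{n+1}$ (the factor for $i=0$ being $1$); $\mathsf{HH}^k(A)=\mathsf{HH}^k(A;A)$. For $g:X\to Y$ let $\zeta(g)=\alpha(\mathrm{Id}_X,\mathrm{Id}_X,g)\,\alpha(g,\mathrm{Id}_Y,\mathrm{Id}_Y)$. The module of invariants $M^A_{\mathcal C}$ consists of the formal sums $m=\sum_Xm_X$, $m_X\in M_{\mathrm{Id}_X}$ ($X\in\mathrm{Ob}(\mathcal C)$), with $\rho_L(a,m)=\zeta(|a|)\rho_R(m,a)$ for all homogeneous $a\in A$ (i.e. $\rho_L(a,m_Y)=\zeta(|a|)\rho_R(m_X,a)$ for $|a|:X\to Y$). $Z^{\mathcal C}(A)$ is the same with $M=A$: $\mu(a,z)=\zeta(|a|)\mu(z,a)$. ''$=$'' means canonical isomorphism of $\Bbbk$-modules. *)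

(* Defs.v *)
From HB Require Import structures.
From mathcomp Require Import all_boot all_algebra.
From mathcomp Require Import ring_quotient generic_quotient ring boolp.

Set Implicit Arguments.
Unset Strict Implicit.
Unset Printing Implicit Defensive.

Import GRing.Theory.
Local Open Scope ring_scope.
Local Open Scope quotient_scope.

Section ModuleConstructions.
Variable k : comPzRingType.

Definition dprod (I : Type) (V : I -> lmodType k) : Type := forall i, V i.

Section DProd.
Variables (I : Type) (V : I -> lmodType k).
Implicit Types u v w : dprod V.

HB.instance Definition _ := gen_eqMixin (dprod V).
HB.instance Definition _ := gen_choiceMixin (dprod V).

Let add u v : dprod V := fun i => u i + v i.
Let opp u : dprod V := fun i => - u i.
Let scale c u : dprod V := fun i => c *: u i.

Fact dprod_addA : associative add.
Proof. by move=> u v w; apply: functional_extensionality_dep => i; apply: addrA. Qed.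
Fact dprod_addC : commutative add.
Proof. by move=> u v; apply: functional_extensionality_dep => i; apply: addrC. Qed.
Fact dprod_add0 : left_id ((fun=> 0) : dprod V) add.
Proof. by move=> u; apply: functional_extensionality_dep => i; apply: add0r. Qed.
Fact dprod_addN : left_inverse ((fun=> 0) : dprod V) opp add.
Proof. by move=> u; apply: functional_extensionality_dep => i; apply: addNr. Qed.

HB.instance Definition _ := GRing.isZmodule.Build (dprod V)
  dprod_addA dprod_addC dprod_add0 dprod_addN.

Fact dprod_scaleA a b u : scale a (scale b u) = scale (a * b) u.
Proof. by apply: functional_extensionality_dep => i; apply: scalerA. Qed.
Fact dprod_scale1 : left_id 1 scale.
Proof. by move=> u; apply: functional_extensionality_dep => i; apply: scale1r. Qed.
Fact dprod_scaleDr : right_distributive scale +%R.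
Proof. by move=> a u v; apply: functional_extensionality_dep => i; apply: scalerDr. Qed.
Fact dprod_scaleDl u : {morph scale^~ u : a b / a + b}.
Proof. by move=> a b; apply: functional_extensionality_dep => i; apply: scalerDl. Qed.

HB.instance Definition _ := GRing.Zmodule_isLmodule.Build k (dprod V)
  dprod_scaleA dprod_scale1 dprod_scaleDr dprod_scaleDl.

End DProd.

Section QuotMod.
Variables (V : lmodType k) (I : submodClosed V).

Let ideal : {pred V} := fun v => v \in I.
Fact quotmod_closed : submod_closed ideal.
Proof.
by split=> [|c u v Iu Iv]; [exact: rpred0 | apply: rpredD Iv; exact: rpredZ].
Qed.
HB.instance Definition _ := GRing.isSubmodClosed.Build k V ideal quotmod_closed.

Definition quotmod : Type := Quotient.quot ideal.
HB.instance Definition _ := GRing.Zmodule.on quotmod.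
Definition qclass (v : V) : quotmod := \pi_(Quotient.quot ideal) v.
Definition qrepr (q : quotmod) : V := repr (q : Quotient.quot ideal).

Lemma qreprK q : qclass (qrepr q) = q.
Proof. exact: reprK. Qed.

Lemma qclassD u v : qclass (u + v) = qclass u + qclass v.
Proof. exact: (Quotient.pi_add ideal). Qed.

Lemma qclass_eq u v : qclass u = qclass v <-> u - v \in I.
Proof.
have -> : (u - v \in I) = (qclass u == qclass v).
  exact: (Quotient.idealrBE ideal u v).
by split=> /eqP.
Qed.

Let scale c (q : quotmod) : quotmod := qclass (c *: qrepr q).

Let scaleE c v : scale c (qclass v) = qclass (c *: v).
Proof.
by apply/qclass_eq; rewrite -scalerBr; apply: rpredZ; apply/qclass_eq; apply: qreprK.
Qed.

Fact quotmod_scaleA a b u : scale a (scale b u) = scale (a * b) u.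
Proof. by rewrite -(qreprK u) !scaleE scalerA. Qed.
Fact quotmod_scale1 : left_id 1 scale.
Proof. by move=> u; rewrite -(qreprK u) scaleE scale1r. Qed.
Fact quotmod_scaleDr : right_distributive scale +%R.
Proof.
by move=> a u v; rewrite -(qreprK u) -(qreprK v) -qclassD !scaleE scalerDr qclassD.
Qed.
Fact quotmod_scaleDl u : {morph scale^~ u : a b / a + b}.
Proof. by move=> a b; rewrite -(qreprK u) !scaleE scalerDl qclassD. Qed.

HB.instance Definition _ := GRing.Zmodule_isLmodule.Build k quotmod
  quotmod_scaleA quotmod_scale1 quotmod_scaleDr quotmod_scaleDl.

Fact qclass_linear : linear qclass.
Proof. by move=> c u v; rewrite qclassD -scaleE. Qed.
HB.instance Definition _ := GRing.isLinear.Build k V quotmod _ qclass qclass_linear.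

End QuotMod.
End ModuleConstructions.

Record category := Category {
  obj :> Type;
  mor : obj -> obj -> Type;
  idm : forall X, mor X X;
  mcomp : forall X Y Z, mor Y Z -> mor X Y -> mor X Z;
  comp1m : forall X Y (f : mor X Y), mcomp (idm Y) f = f;
  compm1 : forall X Y (f : mor X Y), mcomp f (idm X) = f;
  compA : forall X Y Z W (f : mor X Y) (g : mor Y Z) (h : mor Z W),
    mcomp h (mcomp g f) = mcomp (mcomp h g) f }.

Arguments mor {c} X Y.
Arguments idm {c} X.
Arguments mcomp {c X Y Z} g f.
Notation "g \oc f" := (mcomp g f) (at level 50, left associativity).

(* asc takes values in the units of k, ascV being the inverse; k is an arbitrary
   commutative ring, possibly zero, without the unitRingType structure. *)
Record grading (k : comPzRingType) (C : category) := Grading {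
  asc : forall {X Y Z W : C}, mor X Y -> mor Y Z -> mor Z W -> k;
  ascV : forall {X Y Z W : C}, mor X Y -> mor Y Z -> mor Z W -> k;
  ascK : forall (X Y Z W : C) (f1 : mor X Y) (f2 : mor Y Z) (f3 : mor Z W),
    asc f1 f2 f3 * ascV f1 f2 f3 = 1;
  asc_cocycle : forall (X Y Z W V : C)
      (f1 : mor X Y) (f2 : mor Y Z) (f3 : mor Z W) (f4 : mor W V),
    asc f1 f2 f3 * ascV f1 f2 (f4 \oc f3) * asc f1 (f3 \oc f2) f4
      * ascV (f2 \oc f1) f3 f4 * asc f2 f3 f4 = 1 }.
Arguments asc {k C} g {X Y Z W}.
Arguments ascV {k C} g {X Y Z W}.

Lemma ascI k C (a : grading k C) X Y Z W (f1 : mor X Y) (f2 : mor Y Z)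
    (f3 : mor Z W) : injective (fun c => asc a f1 f2 f3 * c).
Proof.
move=> c d /(congr1 ( *%R (ascV a f1 f2 f3))).
by rewrite !mulrA (mulrC (ascV _ _ _ _)) ascK !mul1r.
Qed.

Lemma asc_cocycleM k C (a : grading k C) X Y Z W V (f1 : mor X Y)
    (f2 : mor Y Z) (f3 : mor Z W) (f4 : mor W V) :
  asc a f1 f2 f3 * asc a f1 (f3 \oc f2) f4 * asc a f2 f3 f4 =
  asc a f1 f2 (f4 \oc f3) * asc a (f2 \oc f1) f3 f4.
Proof.
rewrite -[RHS]mulr1 -(asc_cocycle a f1 f2 f3 f4).
set c1 := asc a f1 f2 f3; set c2 := asc a f1 _ f4; set c3 := asc a f2 f3 f4.
have K1 := ascK a f1 f2 (f4 \oc f3); have K2 := ascK a (f2 \oc f1) f3 f4.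
rewrite -[LHS]mulr1 -K1 -[LHS]mulr1 -K2.
move: (asc a f1 f2 _) (ascV a f1 f2 _) (asc a _ f3 f4) (ascV a _ f3 f4) => p p' q q'.
ring.
Qed.

Section Unitors.
Variables (k : comPzRingType) (C : category) (a : grading k C).
Variables (X Y : C) (g : mor X Y).
Definition lunit : k := ascV a (idm X) (idm X) g.
Definition runit : k := asc a g (idm Y) (idm Y).
Definition zeta : k := asc a (idm X) (idm X) g * asc a g (idm Y) (idm Y).
End Unitors.

(* A graded module, the direct sum of its pieces M_g, is represented by the
   family of the pieces.  A product in degree f2 \oc f1 is stated in any degree g
   with a proof of f2 \oc f1 = g, which avoids transports along the category
   axioms. *)
Record gmodule (k : comPzRingType) (C : category) := GModule {
  piece : forall {X Y : C}, mor X Y -> lmodType k }.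
Notation "M \_ f" := (piece M f) (at level 8, f at level 2, format "M \_ f").

Section GradedMaps.
Variables (k : comPzRingType) (C : category) (M N : gmodule k C).

Definition gfamily : Type :=
  dprod (fun X : C => dprod (fun Y : C => dprod (fun f : mor X Y =>
    dprod (fun _ : M\_f => N\_f)))).
HB.instance Definition _ := GRing.Lmodule.on gfamily.

Definition gmap_pred : {pred gfamily} :=
  fun phi => `[< forall X Y (f : mor X Y), linear (phi X Y f) >].

Fact gmap_closed : submod_closed gmap_pred.
Proof.
split=> [|c phi psi /asboolP lphi /asboolP lpsi]; apply/asboolP => X Y f d u v.
  by rewrite scaler0 addr0.
have E w : (c *: phi + psi) X Y f w = c *: phi X Y f w + psi X Y f w by [].
by rewrite !E lphi lpsi !scalerDr !scalerA (mulrC d) addrACA.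
Qed.
HB.instance Definition _ := GRing.isSubmodClosed.Build k gfamily gmap_pred gmap_closed.

Record gmap := GMap { gmap_val : gfamily; gmapP : gmap_val \in gmap_pred }.
HB.instance Definition _ := [isSub for gmap_val].
HB.instance Definition _ := [Choice of gmap by <:].
HB.instance Definition _ := [SubChoice_isSubLmodule of gmap by <:].

Definition gapp (phi : gmap) {X Y : C} {f : mor X Y} (x : M\_f) : N\_f :=
  gmap_val phi x.
Fact gapp_linear phi X Y (f : mor X Y) : linear (@gapp phi X Y f).
Proof. exact: (asboolP _ (gmapP phi)). Qed.
HB.instance Definition _ phi X Y (f : mor X Y) :=
  GRing.isLinear.Build k M\_f N\_f _ (@gapp phi X Y f) (@gapp_linear phi X Y f).

Definition mk_gmap (phi : forall X Y (f : mor X Y), M\_f -> N\_f)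
    (phiL : forall X Y (f : mor X Y), linear (phi X Y f)) : gmap :=
  GMap (introT (asboolP _) phiL).

Lemma gmap_eq (phi psi : gmap) :
  (forall X Y (f : mor X Y) (x : M\_f), gapp phi x = gapp psi x) -> phi = psi.
Proof.
move=> eq_phi; apply: val_inj; do 4 apply: functional_extensionality_dep => ?.
exact: eq_phi.
Qed.

Lemma gapp_0 (phi : gmap) X Y (f : mor X Y) : gapp phi (0 : M\_f) = 0.
Proof. exact: linear0. Qed.
Lemma gapp_D (phi : gmap) X Y (f : mor X Y) (x y : M\_f) :
  gapp phi (x + y) = gapp phi x + gapp phi y.
Proof. exact: linearD. Qed.
Lemma gapp_Z (phi : gmap) c X Y (f : mor X Y) (x : M\_f) :
  gapp phi (c *: x) = c *: gapp phi x.
Proof. exact: linearZ. Qed.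

Lemma gappD phi psi X Y (f : mor X Y) (x : M\_f) :
  gapp (phi + psi) x = gapp phi x + gapp psi x.
Proof. by []. Qed.
Lemma gappZ c phi X Y (f : mor X Y) (x : M\_f) : gapp (c *: phi) x = c *: gapp phi x.
Proof. by []. Qed.
Lemma gapp0 X Y (f : mor X Y) (x : M\_f) : gapp 0 x = 0.
Proof. by []. Qed.

End GradedMaps.

Section Tensor.
Variables (k : comPzRingType) (C : category) (M N : gmodule k C).

Section Degree.
Variables (X Y : C) (g : mor X Y).

Record simple := Simple {
  s_mid : C;
  s_f1 : mor X s_mid;
  s_f2 : mor s_mid Y;
  s_fact : s_f2 \oc s_f1 = g;
  s_x : M\_s_f1;
  s_y : N\_s_f2 }.
HB.instance Definition _ := gen_eqMixin simple.
HB.instance Definition _ := gen_choiceMixin simple.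

(* Sums of simple tensors, as words, modulo k-bilinearity within each
   factorization g = f2 \oc f1: the classes are the elements of the direct sum,
   over all factorizations, of the tensor products of M\_f1 and N\_f2. *)
Inductive tens_rel : seq simple -> seq simple -> Prop :=
| tens_refl s : tens_rel s s
| tens_sym s t : tens_rel s t -> tens_rel t s
| tens_trans s t u : tens_rel s t -> tens_rel t u -> tens_rel s u
| tens_cat s s' t t' : tens_rel s s' -> tens_rel t t' ->
    tens_rel (s ++ t) (s' ++ t')
| tens_comm s t : tens_rel (s ++ t) (t ++ s)
| tens_zero Z (f1 : mor X Z) (f2 : mor Z Y) (e : f2 \oc f1 = g) y :
    tens_rel [:: Simple e 0 y] [::]
| tens_addl Z (f1 : mor X Z) (f2 : mor Z Y) (e : f2 \oc f1 = g) x x' y :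
    tens_rel [:: Simple e (x + x') y] [:: Simple e x y; Simple e x' y]
| tens_addr Z (f1 : mor X Z) (f2 : mor Z Y) (e : f2 \oc f1 = g) x y y' :
    tens_rel [:: Simple e x (y + y')] [:: Simple e x y; Simple e x y']
| tens_scale Z (f1 : mor X Z) (f2 : mor Z Y) (e : f2 \oc f1 = g) c x y :
    tens_rel [:: Simple e (c *: x) y] [:: Simple e x (c *: y)].

Definition tens_relb : rel (seq simple) := fun s t => `[< tens_rel s t >].

Fact tens_rel_equiv : equiv_class_of tens_relb.
Proof.
split=> [s|s t|t s u].
- exact/asboolP/tens_refl.
- by apply/asboolP/asboolP; apply: tens_sym.
- by move=> /asboolP st /asboolP tu; apply/asboolP/(tens_trans st tu).
Qed.
Canonical tens_equiv := EquivRelPack tens_rel_equiv.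
Canonical tens_encModRel := defaultEncModRel tens_relb.

Definition tens : Type := {eq_quot tens_relb}.
HB.instance Definition _ : EqQuotient _ tens_relb tens := EqQuotient.on tens.
HB.instance Definition _ := Choice.on tens.

Definition tclass (s : seq simple) : tens := \pi_tens s.
Definition trepr (u : tens) : seq simple := repr u.

Lemma treprK u : tclass (trepr u) = u.
Proof. exact: reprK. Qed.
Lemma tclassP s t : tclass s = tclass t <-> tens_rel s t.
Proof. by split=> [/eqquotP/asboolP|H]; last exact/eqquotP/asboolP. Qed.
Lemma trepr_rel s : tens_rel (trepr (tclass s)) s.
Proof. exact/tclassP/treprK. Qed.

Definition tadd u v := tclass (trepr u ++ trepr v).
Definition sscale c (s : simple) := Simple (s_fact s) (c *: s_x s) (s_y s).
Definition tscale c u := tclass [seq sscale c s | s <- trepr u].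
Definition topp u := tscale (-1) u.

Lemma tclass_cat s t : tclass (s ++ t) = tadd (tclass s) (tclass t).
Proof. by apply/tclassP/tens_cat; apply: tens_sym; apply: trepr_rel. Qed.

Lemma sscale_rel c s t :
  tens_rel s t -> tens_rel (map (sscale c) s) (map (sscale c) t).
Proof.
elim=> {s t} [s|s t _|s t u _ IHs _ /(tens_trans IHs)//|s s' t t' _ IHs _ IHt
  |s t|Z f1 f2 e y|Z f1 f2 e x x' y|Z f1 f2 e x y y'|Z f1 f2 e d x y] //=.
- exact: tens_refl.
- exact: tens_sym.
- by rewrite !map_cat; apply: tens_cat.
- by rewrite !map_cat; apply: tens_comm.
- by rewrite /sscale /= scaler0; apply: tens_zero.
- by rewrite /sscale /= scalerDr; apply: tens_addl.
- by apply: tens_addr.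
- rewrite /sscale /= scalerA mulrC -scalerA; exact: tens_scale.
Qed.

Lemma tclass_scale c s : tclass (map (sscale c) s) = tscale c (tclass s).
Proof. by apply/tclassP/sscale_rel/tens_sym/trepr_rel. Qed.

Fact tens_addA : associative tadd.
Proof.
by move=> u v w; rewrite -(treprK u) -(treprK v) -(treprK w) -!tclass_cat catA.
Qed.
Fact tens_addC : commutative tadd.
Proof.
move=> u v; rewrite -(treprK u) -(treprK v) -!tclass_cat.
exact/tclassP/tens_comm.
Qed.
Fact tens_add0 : left_id (tclass [::]) tadd.
Proof. by move=> u; rewrite -(treprK u) -tclass_cat. Qed.

Lemma tscaleD c : {morph tscale c : u v / tadd u v >-> tadd u v}.
Proof.
move=> u v; rewrite -(treprK u) -(treprK v) -tclass_cat -!tclass_scale.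
by rewrite map_cat tclass_cat.
Qed.

Lemma tscaleDl u a b : tscale (a + b) u = tadd (tscale a u) (tscale b u).
Proof.
rewrite -(treprK u); elim: (trepr u) => [|s t IHt].
  by rewrite -!tclass_scale /= -tclass_cat.
rewrite -cat1s tclass_cat !tscaleD IHt.
suff -> : tscale (a + b) (tclass [:: s]) =
    tadd (tscale a (tclass [:: s])) (tscale b (tclass [:: s])).
  rewrite -!tens_addA; congr tadd; rewrite !tens_addA; congr tadd.
  exact: tens_addC.
rewrite -!tclass_scale -tclass_cat; apply/tclassP => /=.
by rewrite /sscale scalerDl; apply: tens_addl.
Qed.

Lemma tscale1 u : tscale 1 u = u.
Proof.
rewrite -[u in RHS]treprK; congr tclass; rewrite -[RHS]map_id.
by apply: eq_map => -[Z f1 f2 e x y]; rewrite /sscale /= scale1r.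
Qed.

Lemma tscale0 u : tscale 0 u = tclass [::].
Proof.
rewrite -(treprK u); elim: (trepr u) => [|s t IHt].
  by rewrite -tclass_scale.
rewrite -cat1s tclass_cat tscaleD IHt tens_addC tens_add0 -tclass_scale /=.
by apply/tclassP; rewrite /sscale scale0r; apply: tens_zero.
Qed.

Lemma tscaleA a b u : tscale a (tscale b u) = tscale (a * b) u.
Proof.
rewrite -(treprK u) -!tclass_scale -map_comp; congr tclass.
by apply: eq_map => s; rewrite /= /sscale /= scalerA.
Qed.

Fact tens_addN : left_inverse (tclass [::]) topp tadd.
Proof. by move=> u; rewrite /topp -{2}(tscale1 u) -tscaleDl addNr tscale0. Qed.

HB.instance Definition _ := GRing.isZmodule.Build tens
  tens_addA tens_addC tens_add0 tens_addN.
HB.instance Definition _ := GRing.Zmodule_isLmodule.Build k tens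
  tscaleA tscale1 tscaleD tscaleDl.

Let tens_lin c (u v : tens) : c *: u + v = tadd (tscale c u) v.
Proof. by []. Qed.

Definition tens_pure Z (f1 : mor X Z) (f2 : mor Z Y) (e : f2 \oc f1 = g)
    (x : M\_f1) (y : N\_f2) : tens := tclass [:: Simple e x y].

Fact tens_pure_linearr Z (f1 : mor X Z) (f2 : mor Z Y) (e : f2 \oc f1 = g) x :
  linear (tens_pure e x).
Proof.
move=> c y y'; rewrite /tens_pure tens_lin -tclass_scale -tclass_cat.
apply/tclassP; apply: (tens_trans (tens_addr _ _ _ _)).
rewrite -cat1s; apply: tens_cat; last exact: tens_refl.
exact/tens_sym/tens_scale.
Qed.
HB.instance Definition _ Z (f1 : mor X Z) (f2 : mor Z Y) e x :=
  GRing.isLinear.Build k N\_f2 tens _ (@tens_pure Z f1 f2 e x)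
    (@tens_pure_linearr Z f1 f2 e x).

Fact tens_pure_linearl Z (f1 : mor X Z) (f2 : mor Z Y) (e : f2 \oc f1 = g) y :
  linear (fun x => tens_pure e x y).
Proof.
move=> c x x'; rewrite /tens_pure tens_lin -tclass_scale -tclass_cat.
exact/tclassP/tens_addl.
Qed.

Lemma tens_ind (P : tens -> Prop) :
  P 0 -> (forall u v, P u -> P v -> P (u + v)) ->
  (forall Z (f1 : mor X Z) (f2 : mor Z Y) (e : f2 \oc f1 = g) x y,
     P (tens_pure e x y)) ->
  forall u, P u.
Proof.
move=> P0 PD Pp u; rewrite -(treprK u); elim: (trepr u) => //= s t IHt.
by rewrite -cat1s tclass_cat; apply: PD => //; case: s => *; apply: Pp.
Qed.

Section Lift.
Variables (V : lmodType k).
Variable b : forall Z (f1 : mor X Z) (f2 : mor Z Y),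
  f2 \oc f1 = g -> M\_f1 -> N\_f2 -> V.

Definition bilin := forall Z (f1 : mor X Z) (f2 : mor Z Y) (e : f2 \oc f1 = g),
  (forall x, linear (b e x)) /\ (forall y, linear (b e ^~ y)).

Let wsum (s : seq simple) : V := \sum_(t <- s) b (s_fact t) (s_x t) (s_y t).

Definition tlift (u : tens) : V := wsum (trepr u).

Hypothesis bP : bilin.

Let bDl Z (f1 : mor X Z) (f2 : mor Z Y) (e : f2 \oc f1 = g) x x' y :
  b e (x + x') y = b e x y + b e x' y.
Proof. by have [_ /(_ y 1 x x')] := bP e; rewrite !scale1r. Qed.
Let bDr Z (f1 : mor X Z) (f2 : mor Z Y) (e : f2 \oc f1 = g) x y y' :
  b e x (y + y') = b e x y + b e x y'.
Proof. by have [/(_ x 1 y y') + _] := bP e; rewrite !scale1r. Qed.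
Let b0l Z (f1 : mor X Z) (f2 : mor Z Y) (e : f2 \oc f1 = g) y : b e 0 y = 0.
Proof. by apply: (addrI (b e 0 y)); rewrite -bDl !addr0. Qed.
Let b0r Z (f1 : mor X Z) (f2 : mor Z Y) (e : f2 \oc f1 = g) x : b e x 0 = 0.
Proof. by apply: (addrI (b e x 0)); rewrite -bDr !addr0. Qed.
Let bZl Z (f1 : mor X Z) (f2 : mor Z Y) (e : f2 \oc f1 = g) c x y :
  b e (c *: x) y = c *: b e x y.
Proof. by have [_ /(_ y c x 0)] := bP e; rewrite b0l !addr0. Qed.
Let bZr Z (f1 : mor X Z) (f2 : mor Z Y) (e : f2 \oc f1 = g) c x y :
  b e x (c *: y) = c *: b e x y.
Proof. by have [/(_ x c y 0) + _] := bP e; rewrite b0r !addr0. Qed.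

Let wsum_rel s t : tens_rel s t -> wsum s = wsum t.
Proof.
rewrite /wsum; elim=> {s t} [s|s t _|s t u _ -> _ ->|s s' t t' _ IHs _ IHt
  |s t|Z f1 f2 e y|Z f1 f2 e x x' y|Z f1 f2 e x y y'|Z f1 f2 e d x y] //=.
- by rewrite !big_cat /= IHs IHt.
- by rewrite !big_cat /= addrC.
- by rewrite big_seq1 big_nil /= b0l.
- by rewrite !big_cons big_nil /= !addr0 bDl.
- by rewrite !big_cons big_nil /= !addr0 bDr.
- by rewrite !big_seq1 /= bZl bZr.
Qed.

Let tlift_class s : tlift (tclass s) = wsum s.
Proof. exact/wsum_rel/trepr_rel. Qed.

Lemma tlift_linear : linear tlift.
Proof.
move=> c u v; rewrite -(treprK u) -(treprK v).
rewrite tens_lin -tclass_scale -tclass_cat !tlift_class.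
rewrite /wsum big_cat big_map /= scaler_sumr; congr (_ + _).
by apply: eq_bigr => s _; rewrite bZl.
Qed.

Lemma tlift_pure Z (f1 : mor X Z) (f2 : mor Z Y) (e : f2 \oc f1 = g) x y :
  tlift (tens_pure e x y) = b e x y.
Proof. by rewrite tlift_class /wsum big_seq1. Qed.

End Lift.
End Degree.

Definition tensor : gmodule k C := GModule (fun X Y (g : mor X Y) => tens g : lmodType k).

Definition tpure X Y Z (f1 : mor X Z) (f2 : mor Z Y) (g : mor X Y)
    (e : f2 \oc f1 = g) (x : M\_f1) (y : N\_f2) : tensor\_g := tens_pure e x y.

Section GradedLift.
Variables (P : gmodule k C).
Variable b : forall X Y (g : mor X Y) Z (f1 : mor X Z) (f2 : mor Z Y),
  f2 \oc f1 = g -> M\_f1 -> N\_f2 -> P\_g.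
Hypothesis bP : forall X Y (g : mor X Y), bilin (@b X Y g).

Definition glift : gmap tensor P :=
  @mk_gmap k C tensor P (fun X Y g => tlift (@b X Y g))
    (fun X Y g => tlift_linear (@bP X Y g)).

Lemma glift_pure X Y (g : mor X Y) Z (f1 : mor X Z) (f2 : mor Z Y)
    (e : f2 \oc f1 = g) x y :
  gapp glift (tpure e x y) = b e x y.
Proof. exact: (tlift_pure (@bP X Y g)). Qed.
End GradedLift.

Section TensorTheory.
Variables (X Y Z : C) (f1 : mor X Z) (f2 : mor Z Y) (g : mor X Y).
Variable e : f2 \oc f1 = g.
Lemma tpureDl x x' y : tpure e (x + x') y = tpure e x y + tpure e x' y.
Proof. by have := tens_pure_linearl e y 1 x x'; rewrite !scale1r. Qed.
Lemma tpureDr x y y' : tpure e x (y + y') = tpure e x y + tpure e x y'.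
Proof. by have := tens_pure_linearr e x 1 y y'; rewrite !scale1r. Qed.
Lemma tpure0l y : tpure e 0 y = 0.
Proof. by apply: (addrI (tpure e 0 y)); rewrite -tpureDl !addr0. Qed.
Lemma tpure0r x : tpure e x 0 = 0.
Proof. by apply: (addrI (tpure e x 0)); rewrite -tpureDr !addr0. Qed.
Lemma tpureZl c x y : tpure e (c *: x) y = c *: tpure e x y.
Proof.
by have := tens_pure_linearl e y c x 0; rewrite addr0 [X in _ + X]tpure0l addr0.
Qed.
Lemma tpureZr c x y : tpure e x (c *: y) = c *: tpure e x y.
Proof.
by have := tens_pure_linearr e x c y 0; rewrite addr0 [X in _ + X]tpure0r addr0.
Qed.
End TensorTheory.

Lemma tensor_ind X Y (g : mor X Y) (P : tensor\_g -> Prop) :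
  P 0 -> (forall u v, P u -> P v -> P (u + v)) ->
  (forall Z (f1 : mor X Z) (f2 : mor Z Y) (e : f2 \oc f1 = g) x y,
     P (tpure e x y)) ->
  forall u, P u.
Proof. exact: tens_ind. Qed.

End Tensor.

Record galgebra (k : comPzRingType) (C : category) (a : grading k C) := GAlgebra {
  acar :> gmodule k C;
  amul : gmap (tensor acar acar) acar;
  aone : forall X, acar\_(idm X);
  amulA : forall (X Y Z W : C) (f1 : mor X Y) (f2 : mor Y Z) (f3 : mor Z W)
      f12 f23 f (e12 : f2 \oc f1 = f12) (e23 : f3 \oc f2 = f23)
      (el : f3 \oc f12 = f) (er : f23 \oc f1 = f)
      (x : acar\_f1) (y : acar\_f2) (z : acar\_f3),
    gapp amul (tpure el (gapp amul (tpure e12 x y)) z) =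
    asc a f1 f2 f3 *: gapp amul (tpure er x (gapp amul (tpure e23 y z)));
  amul1l : forall (X Y : C) (f : mor X Y) (e : f \oc idm X = f) (x : acar\_f),
    gapp amul (tpure e (aone X) x) = lunit a f *: x;
  amul1r : forall (X Y : C) (f : mor X Y) (e : idm Y \oc f = f) (x : acar\_f),
    gapp amul (tpure e x (aone Y)) = runit a f *: x }.

Record bimodule (k : comPzRingType) (C : category) (a : grading k C)
    (A : galgebra a) := Bimodule {
  bcar :> gmodule k C;
  actl : gmap (tensor A bcar) bcar;
  actr : gmap (tensor bcar A) bcar;
  actlA : forall (X Y Z W : C) (f1 : mor X Y) (f2 : mor Y Z) (f3 : mor Z W)
      f12 f23 f (e12 : f2 \oc f1 = f12) (e23 : f3 \oc f2 = f23)
      (el : f3 \oc f12 = f) (er : f23 \oc f1 = f)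
      (x : A\_f1) (y : A\_f2) (m : bcar\_f3),
    gapp actl (tpure el (gapp (amul A) (tpure e12 x y)) m) =
    asc a f1 f2 f3 *: gapp actl (tpure er x (gapp actl (tpure e23 y m)));
  actrA : forall (X Y Z W : C) (f1 : mor X Y) (f2 : mor Y Z) (f3 : mor Z W)
      f12 f23 f (e12 : f2 \oc f1 = f12) (e23 : f3 \oc f2 = f23)
      (el : f3 \oc f12 = f) (er : f23 \oc f1 = f)
      (m : bcar\_f1) (x : A\_f2) (y : A\_f3),
    gapp actr (tpure el (gapp actr (tpure e12 m x)) y) =
    asc a f1 f2 f3 *: gapp actr (tpure er m (gapp (amul A) (tpure e23 x y)));
  actlrA : forall (X Y Z W : C) (f1 : mor X Y) (f2 : mor Y Z) (f3 : mor Z W)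
      f12 f23 f (e12 : f2 \oc f1 = f12) (e23 : f3 \oc f2 = f23)
      (el : f3 \oc f12 = f) (er : f23 \oc f1 = f)
      (x : A\_f1) (m : bcar\_f2) (y : A\_f3),
    gapp actr (tpure el (gapp actl (tpure e12 x m)) y) =
    asc a f1 f2 f3 *: gapp actl (tpure er x (gapp actr (tpure e23 m y)));
  actl1 : forall (X Y : C) (f : mor X Y) (e : f \oc idm X = f) (m : bcar\_f),
    gapp actl (tpure e (aone A X) m) = lunit a f *: m;
  actr1 : forall (X Y : C) (f : mor X Y) (e : idm Y \oc f = f) (m : bcar\_f),
    gapp actr (tpure e m (aone A Y)) = runit a f *: m }.

Arguments actl {k C a A} b.
Arguments actr {k C a A} b.

Section Linear.
Variables (k : comPzRingType) (U V : lmodType k) (F : U -> V).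
Hypothesis FL : linear F.
Lemma linD u v : F (u + v) = F u + F v.
Proof. by have := FL 1 u v; rewrite !scale1r. Qed.
Lemma lin0 : F 0 = 0.
Proof. by apply: (addrI (F 0)); rewrite -linD !addr0. Qed.
End Linear.

Section Bimodules.
Variables (k : comPzRingType) (C : category) (a : grading k C) (A : galgebra a).

Definition regular : bimodule A :=
  @Bimodule k C a A A (amul A) (amul A) (@amulA _ _ _ A) (@amulA _ _ _ A)
    (@amulA _ _ _ A) (@amul1l _ _ _ A) (@amul1r _ _ _ A).

Section Hom.
Variables M N : bimodule A.

Definition bhom_pred : {pred gmap M N} := fun phi =>
  `[< (forall (X Y Z : C) (f1 : mor X Z) (f2 : mor Z Y) g (e : f2 \oc f1 = g)
         (x : A\_f1) (m : M\_f2),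
         gapp phi (gapp (actl M) (tpure e x m)) =
         gapp (actl N) (tpure e x (gapp phi m)))
   /\ (forall (X Y Z : C) (f1 : mor X Z) (f2 : mor Z Y) g (e : f2 \oc f1 = g)
         (m : M\_f1) (x : A\_f2),
         gapp phi (gapp (actr M) (tpure e m x)) =
         gapp (actr N) (tpure e (gapp phi m) x)) >].

Fact bhom_closed : submod_closed bhom_pred.
Proof.
split=> [|c phi psi /asboolP[lphi rphi] /asboolP[lpsi rpsi]];
  apply/asboolP; split=> *; rewrite ?gapp0 ?tpure0l ?tpure0r ?linear0 //.
- by rewrite !gappD !gappZ lphi lpsi tpureDr tpureZr linearP.
- by rewrite !gappD !gappZ rphi rpsi tpureDl tpureZl linearP.
Qed.
HB.instance Definition _ := GRing.isSubmodClosed.Build k (gmap M N) bhom_pred bhom_closed.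

Record bhom := BHom { bhom_val :> gmap M N; bhomP : bhom_val \in bhom_pred }.
HB.instance Definition _ := [isSub for bhom_val].
HB.instance Definition _ := [Choice of bhom by <:].
HB.instance Definition _ := [SubChoice_isSubLmodule of bhom by <:].

Lemma bhom_eq (phi psi : bhom) :
  (forall X Y (f : mor X Y) (x : M\_f), gapp phi x = gapp psi x) -> phi = psi.
Proof. by move=> eq_phi; apply/val_inj/gmap_eq. Qed.

Lemma bhomDE (phi psi : bhom) X Y (f : mor X Y) (x : M\_f) :
  gapp (phi + psi : bhom) x = gapp phi x + gapp psi x.
Proof. by []. Qed.
Lemma bhomZE c (phi : bhom) X Y (f : mor X Y) (x : M\_f) :
  gapp (c *: phi : bhom) x = c *: gapp phi x.
Proof. by []. Qed.
Lemma bhom0E X Y (f : mor X Y) (x : M\_f) : gapp (0 : bhom) x = 0.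
Proof. by []. Qed.

Section Theory.
Variable phi : bhom.
Lemma bhom_l (X Y Z : C) (f1 : mor X Z) (f2 : mor Z Y) g (e : f2 \oc f1 = g)
    (x : A\_f1) (m : M\_f2) :
  gapp phi (gapp (actl M) (tpure e x m)) = gapp (actl N) (tpure e x (gapp phi m)).
Proof. by have /asboolP[H _] := bhomP phi; apply: H. Qed.
Lemma bhom_r (X Y Z : C) (f1 : mor X Z) (f2 : mor Z Y) g (e : f2 \oc f1 = g)
    (m : M\_f1) (x : A\_f2) :
  gapp phi (gapp (actr M) (tpure e m x)) = gapp (actr N) (tpure e (gapp phi m) x).
Proof. by have /asboolP[_ H] := bhomP phi; apply: H. Qed.
End Theory.
End Hom.

(* For homogeneous x, n, b,
     x (n (x) b) = alpha(|x|, |n|, |b|)^-1 (x n) (x) b,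
     (n (x) b) x = alpha(|n|, |b|, |x|) n (x) (b x).
   Iterated from N = A, with n = a_0 (x) ... (x) a_(i-1) and b = a_i, the first
   rule yields the product over i of
     alpha(|x|, |a_(i-1)| o ... o |a_0|, |a_i|)^-1. *)
Section TensorBimodule.
Variable N : bimodule A.
Let NA := tensor N A.

Section LeftAction.
Variables (X Z Y : C) (f : mor X Z) (g : mor Z Y) (h : mor X Y) (e : g \oc f = h).

Fact left_fact W (f1 : mor Z W) (f2 : mor W Y) :
  f2 \oc f1 = g -> f2 \oc (f1 \oc f) = h.
Proof. by move=> e1; rewrite compA e1. Qed.

Definition tactl_fun (x : A\_f) W (f1 : mor Z W) (f2 : mor W Y)
    (e1 : f2 \oc f1 = g) (n : N\_f1) (b : A\_f2) : NA\_h :=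
  ascV a f f1 f2 *: tpure (left_fact e1) (gapp (actl N) (tpure erefl x n)) b.

Fact tactl_fun_bilin x : bilin (tactl_fun x).
Proof.
move=> W f1 f2 e1; split=> [n c b b'|b c n n']; rewrite /tactl_fun.
  by rewrite tpureDr tpureZr scalerDr !scalerA mulrC.
by rewrite tpureDr tpureZr linearP tpureDl tpureZl scalerDr !scalerA mulrC.
Qed.
End LeftAction.

Definition tactl_bil X Y (h : mor X Y) Z (f : mor X Z) (g : mor Z Y)
    (e : g \oc f = h) (x : A\_f) (u : NA\_g) : NA\_h := tlift (tactl_fun e x) u.

Fact tactl_bilin X Y (h : mor X Y) : bilin (@tactl_bil X Y h).
Proof.
move=> Z f g e; split=> [x|u c x x']; first exact/tlift_linear/tactl_fun_bilin.
have L y : linear (tactl_bil e y) by exact/tlift_linear/tactl_fun_bilin.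
elim/tensor_ind: u => [|u v IHu IHv|W f1 f2 e1 n b].
- by rewrite !(lin0 (L _)) scaler0 addr0.
- by rewrite !(linD (L _)) IHu IHv scalerDr addrACA.
rewrite /tactl_bil !(tlift_pure (tactl_fun_bilin _ _)) /tactl_fun.
by rewrite tpureDl tpureZl linearP tpureDl tpureZl scalerDr !scalerA mulrC.
Qed.

Definition tactl : gmap (tensor A NA) NA := glift tactl_bilin.

Lemma tactlE X Y Z W (f : mor X Z) (f1 : mor Z W) (f2 : mor W Y) g f' h
    (e1 : f2 \oc f1 = g) (e : g \oc f = h) (e3 : f1 \oc f = f') (e2 : f2 \oc f' = h)
    (x : A\_f) (n : N\_f1) (b : A\_f2) :
  gapp tactl (tpure e x (tpure e1 n b)) =
  ascV a f f1 f2 *: tpure e2 (gapp (actl N) (tpure e3 x n)) b.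
Proof.
rewrite glift_pure /tactl_bil (tlift_pure (tactl_fun_bilin _ _)) /tactl_fun.
by case: f' / e3 e2 => e2; rewrite (Prop_irrelevance e2 (left_fact e e1)).
Qed.

Section RightAction.
Variables (X Z Y : C) (g : mor X Z) (f : mor Z Y) (h : mor X Y) (e : f \oc g = h).

Fact right_fact W (f1 : mor X W) (f2 : mor W Z) :
  f2 \oc f1 = g -> (f \oc f2) \oc f1 = h.
Proof. by move=> e1; rewrite -compA e1. Qed.

Definition tactr_fun (x : A\_f) W (f1 : mor X W) (f2 : mor W Z)
    (e1 : f2 \oc f1 = g) (n : N\_f1) (b : A\_f2) : NA\_h :=
  asc a f1 f2 f *: tpure (right_fact e1) n (gapp (amul A) (tpure erefl b x)).

Fact tactr_fun_bilin x : bilin (tactr_fun x).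
Proof.
move=> W f1 f2 e1; split=> [n c b b'|b c n n']; rewrite /tactr_fun.
  by rewrite tpureDl tpureZl linearP tpureDr tpureZr scalerDr !scalerA mulrC.
by rewrite tpureDl tpureZl scalerDr !scalerA mulrC.
Qed.
End RightAction.

Definition tactr_bil X Y (h : mor X Y) Z (g : mor X Z) (f : mor Z Y)
    (e : f \oc g = h) (u : NA\_g) (x : A\_f) : NA\_h := tlift (tactr_fun e x) u.

Fact tactr_bilin X Y (h : mor X Y) : bilin (@tactr_bil X Y h).
Proof.
move=> Z g f e; split=> [u c x x'|x]; last exact/tlift_linear/tactr_fun_bilin.
have L y : linear (tactr_bil e ^~ y) by exact/tlift_linear/tactr_fun_bilin.
elim/tensor_ind: u => [|u v IHu IHv|W f1 f2 e1 n b].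
- by rewrite !(lin0 (L _)) scaler0 addr0.
- by rewrite !(linD (L _)) IHu IHv scalerDr addrACA.
rewrite /tactr_bil !(tlift_pure (tactr_fun_bilin _ _)) /tactr_fun.
by rewrite tpureDr tpureZr linearP tpureDr tpureZr scalerDr !scalerA mulrC.
Qed.

Definition tactr : gmap (tensor NA A) NA := glift tactr_bilin.

Lemma tactrE X Y Z W (f1 : mor X W) (f2 : mor W Z) (f : mor Z Y) g f' h
    (e1 : f2 \oc f1 = g) (e : f \oc g = h) (e3 : f \oc f2 = f') (e2 : f' \oc f1 = h)
    (n : N\_f1) (b : A\_f2) (x : A\_f) :
  gapp tactr (tpure e (tpure e1 n b) x) =
  asc a f1 f2 f *: tpure e2 n (gapp (amul A) (tpure e3 b x)).
Proof.
rewrite glift_pure /tactr_bil (tlift_pure (tactr_fun_bilin _ _)) /tactr_fun.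
by case: f' / e3 e2 => e2; rewrite (Prop_irrelevance e2 (right_fact e e1)).
Qed.

Fact tactlA (X Y Z W : C) (f1 : mor X Y) (f2 : mor Y Z) (f3 : mor Z W)
    f12 f23 f (e12 : f2 \oc f1 = f12) (e23 : f3 \oc f2 = f23)
    (el : f3 \oc f12 = f) (er : f23 \oc f1 = f)
    (x : A\_f1) (y : A\_f2) (m : NA\_f3) :
  gapp tactl (tpure el (gapp (amul A) (tpure e12 x y)) m) =
  asc a f1 f2 f3 *: gapp tactl (tpure er x (gapp tactl (tpure e23 y m))).
Proof.
elim/tensor_ind: m => [|u v IHu IHv|V g1 g2 e n b].
- by rewrite !(tpure0r, gapp_0) scaler0.
- by rewrite !(tpureDr, gapp_D) IHu IHv scalerDr.
have E2 : g2 \oc (g1 \oc f2) = f23 by rewrite compA e.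
have E3 : (g1 \oc f2) \oc f1 = g1 \oc f12 by rewrite -compA e12.
have E4 : g2 \oc (g1 \oc f12) = f by rewrite compA e.
rewrite (tactlE e e23 erefl E2) tpureZr gapp_Z (tactlE E2 er E3 E4).
rewrite (tactlE e el erefl E4) (actlA e12 erefl erefl E3) tpureZl !scalerA.
congr (_ *: _); rewrite -e12 -e; have := asc_cocycleM a f1 f2 g1 g2.
have := ascK a f1 (g1 \oc f2) g2; have := ascK a f2 g1 g2.
have := ascK a (f2 \oc f1) g1 g2.
move: (asc _ _ _ _) (ascV _ _ _ _) => p p'.
move: (asc _ f2 _ _) (ascV _ _ _ _) => q q'.
move: (asc _ _ (g1 \oc f2) _) (ascV _ _ _ _) => r r' Kp Kq Kr H.
rewrite -[LHS]mulr1 -Kq -[LHS]mulr1 -Kr.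
transitivity (p' * (asc a f1 f2 g1 * r * q) * q' * r'); first by ring.
rewrite H; set d := asc _ _ _ _.
by transitivity (d * q' * r' * (p * p')); [ring | rewrite Kp mulr1].
Qed.

Fact tactrA (X Y Z W : C) (f1 : mor X Y) (f2 : mor Y Z) (f3 : mor Z W)
    f12 f23 f (e12 : f2 \oc f1 = f12) (e23 : f3 \oc f2 = f23)
    (el : f3 \oc f12 = f) (er : f23 \oc f1 = f)
    (m : NA\_f1) (x : A\_f2) (y : A\_f3) :
  gapp tactr (tpure el (gapp tactr (tpure e12 m x)) y) =
  asc a f1 f2 f3 *: gapp tactr (tpure er m (gapp (amul A) (tpure e23 x y))).
Proof.
elim/tensor_ind: m => [|u v IHu IHv|V g1 g2 e n b].
- by rewrite !(tpure0l, gapp_0) scaler0.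
- by rewrite !(tpureDl, gapp_D) IHu IHv scalerDr.
have E2 : (f2 \oc g2) \oc g1 = f12 by rewrite -compA e.
have E3 : f3 \oc (f2 \oc g2) = f23 \oc g2 by rewrite compA e23.
have E4 : (f23 \oc g2) \oc g1 = f by rewrite -compA e.
rewrite (tactrE e e12 erefl E2) tpureZl gapp_Z (tactrE E2 el E3 E4).
rewrite (tactrE e er erefl E4) (amulA erefl e23 E3 erefl) tpureZr !scalerA.
congr (_ *: _); rewrite -e23 -e asc_cocycleM; exact: mulrC.
Qed.

Fact tactlrA (X Y Z W : C) (f1 : mor X Y) (f2 : mor Y Z) (f3 : mor Z W)
    f12 f23 f (e12 : f2 \oc f1 = f12) (e23 : f3 \oc f2 = f23)
    (el : f3 \oc f12 = f) (er : f23 \oc f1 = f)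
    (x : A\_f1) (m : NA\_f2) (y : A\_f3) :
  gapp tactr (tpure el (gapp tactl (tpure e12 x m)) y) =
  asc a f1 f2 f3 *: gapp tactl (tpure er x (gapp tactr (tpure e23 m y))).
Proof.
elim/tensor_ind: m => [|u v IHu IHv|V g1 g2 e n b].
- by rewrite !(tpure0l, tpure0r, gapp_0) scaler0.
- by rewrite !(tpureDr, tpureDl, gapp_D) IHu IHv scalerDr.
have E2 : g2 \oc (g1 \oc f1) = f12 by rewrite compA e.
have E3 : (f3 \oc g2) \oc g1 = f23 by rewrite -compA e.
have E4 : (f3 \oc g2) \oc (g1 \oc f1) = f by rewrite -compA E2.
rewrite (tactlE e e12 erefl E2) tpureZl gapp_Z (tactrE E2 el erefl E4).
rewrite (tactrE e e23 erefl E3) tpureZr gapp_Z (tactlE E3 er erefl E4) !scalerA.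
congr (_ *: _); rewrite -e.
have := asc_cocycleM a f1 g1 g2 f3; have := ascK a f1 g1 g2.
have := ascK a f1 g1 (f3 \oc g2).
move: (asc _ _ _ (f3 \oc g2)) (ascV _ _ _ (f3 \oc g2)) => p p'.
move: (asc _ _ g1 g2) (ascV _ _ g1 g2) => q q' Kp Kq H.
rewrite -[LHS]mulr1 -Kp; transitivity (q' * p' * (p * asc a (g1 \oc f1) g2 f3)).
  by ring.
rewrite -H; set c := asc _ _ _ _; set d := asc _ _ _ _.
by transitivity (c * d * p' * (q * q')); [ring | rewrite Kq mulr1].
Qed.

Fact tactl1 (X Y : C) (f : mor X Y) (e : f \oc idm X = f) (m : NA\_f) :
  gapp tactl (tpure e (aone A X) m) = lunit a f *: m.
Proof.
elim/tensor_ind: m => [|u v IHu IHv|V g1 g2 e1 n b].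
- by rewrite !(tpure0r, gapp_0) scaler0.
- by rewrite !(tpureDr, gapp_D) IHu IHv scalerDr.
rewrite (tactlE e1 e (compm1 g1) e1) actl1 tpureZl scalerA /lunit.
congr (_ *: _); rewrite -e1.
have := asc_cocycleM a (idm X) (idm X) g1 g2; rewrite !compm1.
have := ascK a (idm X) (idm X) (g2 \oc g1); have := ascK a (idm X) (idm X) g1.
have := ascK a (idm X) g1 g2.
move: (asc _ _ _ (g2 \oc g1)) (ascV _ _ _ (g2 \oc g1)) => p p'.
move: (asc _ _ g1 g2) (ascV _ _ g1 g2) => q q'.
move: (asc _ _ _ _) (ascV _ _ _ _) => r r' Kq Kr Kp H.
rewrite -[LHS]mulr1 -Kp -[LHS]mulr1 -Kq.
transitivity (p' * r' * (p * q) * q' * q'); first by ring.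
rewrite -H; transitivity (p' * (r * r') * (q * q') * (q * q')); first by ring.
by rewrite Kr !Kq !mulr1.
Qed.

Fact tactr1 (X Y : C) (f : mor X Y) (e : idm Y \oc f = f) (m : NA\_f) :
  gapp tactr (tpure e m (aone A Y)) = runit a f *: m.
Proof.
elim/tensor_ind: m => [|u v IHu IHv|V g1 g2 e1 n b].
- by rewrite !(tpure0l, gapp_0) scaler0.
- by rewrite !(tpureDl, gapp_D) IHu IHv scalerDr.
rewrite (tactrE e1 e (comp1m g2) e1) amul1r tpureZr scalerA /runit.
congr (_ *: _); rewrite -e1; have := asc_cocycleM a g1 g2 (idm Y) (idm Y).
by rewrite !comp1m -mulrA => /ascI.
Qed.

Definition tensor_bimodule : bimodule A :=
  Bimodule tactlA tactrA tactlrA tactl1 tactr1.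

Fact actr_bhom : actr N \in @bhom_pred tensor_bimodule N.
Proof.
apply/asboolP; split=> X Y Z f1 f2 g e.
  move=> x m; elim/tensor_ind: m => [|u v IHu IHv|V g1 g2 e1 n b].
  - by rewrite !(tpure0r, gapp_0).
  - by rewrite !(tpureDr, gapp_D) IHu IHv.
  have E4 : g2 \oc (g1 \oc f1) = g by rewrite compA e1.
  rewrite (tactlE e1 e erefl E4) gapp_Z (actlrA erefl e1 E4 e) scalerA.
  by rewrite mulrC ascK scale1r.
move=> m x; elim/tensor_ind: m => [|u v IHu IHv|V g1 g2 e1 n b].
- by rewrite !(tpure0l, gapp_0).
- by rewrite !(tpureDl, gapp_D) IHu IHv.
have E4 : (f2 \oc g2) \oc g1 = g by rewrite -compA e1.
by rewrite (tactrE e1 e erefl E4) gapp_Z (actrA e1 erefl e E4).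
Qed.
Definition actr_hom : bhom tensor_bimodule N := BHom actr_bhom.

End TensorBimodule.

Section TensorHom.
Variables (M N : bimodule A) (phi : bhom M N).

Definition tmap_bil X Y (h : mor X Y) Z (f1 : mor X Z) (f2 : mor Z Y)
    (e : f2 \oc f1 = h) (m : M\_f1) (x : A\_f2) : (tensor N A)\_h :=
  tpure e (gapp phi m) x.

Fact tmap_bilin X Y (h : mor X Y) : bilin (@tmap_bil X Y h).
Proof.
move=> Z f g e; split=> [m c x x'|x c m m']; rewrite /tmap_bil.
  by rewrite tpureDr tpureZr.
by rewrite linearP tpureDl tpureZl.
Qed.

Definition tmap_gmap := glift tmap_bilin.

Lemma tmap_gmapE X Y Z (f1 : mor X Z) (f2 : mor Z Y) (g : mor X Y)
    (e : f2 \oc f1 = g) (m : M\_f1) (x : A\_f2) :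
  gapp tmap_gmap (tpure e m x) = tpure e (gapp phi m) x.
Proof. exact: glift_pure. Qed.

Fact tmap_bhom :
  tmap_gmap \in @bhom_pred (tensor_bimodule M) (tensor_bimodule N).
Proof.
apply/asboolP; split=> X Y Z f1 f2 g e.
  move=> x m; elim/tensor_ind: m => [|u v IHu IHv|V g1 g2 e1 n b].
  - by rewrite !(tpure0r, gapp_0).
  - by rewrite !(tpureDr, gapp_D) IHu IHv.
  have E4 : g2 \oc (g1 \oc f1) = g by rewrite compA e1.
  rewrite (tactlE e1 e erefl E4) gapp_Z !tmap_gmapE bhom_l.
  by rewrite (tactlE e1 e erefl E4).
move=> m x; elim/tensor_ind: m => [|u v IHu IHv|V g1 g2 e1 n b].
- by rewrite !(tpure0l, gapp_0).
- by rewrite !(tpureDl, gapp_D) IHu IHv.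
have E4 : (f2 \oc g2) \oc g1 = g by rewrite -compA e1.
rewrite (tactrE e1 e erefl E4) gapp_Z !tmap_gmapE.
by rewrite (tactrE e1 e erefl E4).
Qed.
Definition tmap : bhom (tensor_bimodule M) (tensor_bimodule N) := BHom tmap_bhom.

End TensorHom.

Section Composition.
Variables (L M N : bimodule A) (psi : bhom M N) (phi : bhom L M).

Fact bcomp_linear X Y (f : mor X Y) : linear (fun x : L\_f => gapp psi (gapp phi x)).
Proof. by move=> c x y; rewrite !linearP. Qed.

Definition bcomp_gmap : gmap L N := mk_gmap bcomp_linear.

Let bcomp_gmapE X Y (f : mor X Y) (x : L\_f) :
  gapp bcomp_gmap x = gapp psi (gapp phi x).
Proof. by []. Qed.

Fact bcomp_bhom : bcomp_gmap \in @bhom_pred L N.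
Proof.
by apply/asboolP; split=> X Y Z f1 f2 g e x y; rewrite !bcomp_gmapE ?bhom_l ?bhom_r.
Qed.
Definition bcomp : bhom L N := BHom bcomp_bhom.

Lemma bcompE X Y (f : mor X Y) (x : L\_f) : gapp bcomp x = gapp psi (gapp phi x).
Proof. by []. Qed.
End Composition.

(* bar n is the tensor power of A with n.+1 factors, parenthesized to the left. *)
Fixpoint bar (n : nat) : bimodule A :=
  if n is n'.+1 then tensor_bimodule (bar n') else regular.

(* The differential from n.+2 to n.+1 factors,
     \sum_(i <= n) (-1)^i alpha(|a_(i-1)| o ... o |a_0|, |a_i|, |a_(i+1)|)
       a_0 (x) ... (x) a_i a_(i+1) (x) ... (x) a_(n+1),
   with coefficient 1 at i = 0.  The terms i < n leave a_(n+1) untouched; up to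
   the sign, the term i = n is the right action of a_(n+1) on
   a_0 (x) ... (x) a_n. *)
Fixpoint bard (n : nat) : bhom (bar n.+1) (bar n) :=
  match n return bhom (bar n.+1) (bar n) with
  | 0 => actr_hom (bar 0)
  | n'.+1 => tmap (bard n') + (-1) ^+ n'.+1 *: actr_hom (bar n'.+1)
  end.

Let actr_homE (N : bimodule A) X Y (f : mor X Y) (x : (tensor_bimodule N)\_f) :
  gapp (actr_hom N) x = gapp (actr N) x.
Proof. by []. Qed.

Let tmapE (M N : bimodule A) (phi : bhom M N) X Y Z (f1 : mor X Z)
    (f2 : mor Z Y) (g : mor X Y) (e : f2 \oc f1 = g) (m : M\_f1) (x : A\_f2) :
  gapp (tmap phi) (tpure e m x) = tpure e (gapp phi m) x.
Proof. exact: tmap_gmapE. Qed.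

Lemma bardSE n X Y Z (f1 : mor X Z) (f2 : mor Z Y) (g : mor X Y)
    (e : f2 \oc f1 = g) (m : (bar n.+1)\_f1) (x : A\_f2) :
  gapp (bard n.+1) (tpure e m x : (bar n.+2)\_g) =
  tpure e (gapp (bard n) m) x
    + (-1) ^+ n.+1 *: gapp (actr (bar n.+1)) (tpure e m x).
Proof. by rewrite [bard n.+1]/= bhomDE bhomZE actr_homE tmapE. Qed.

Let bard2E n X Y Z (f1 : mor X Z) (f2 : mor Z Y) (g : mor X Y)
    (e : f2 \oc f1 = g) (m : (bar n.+1)\_f1) (x : A\_f2) :
  gapp (bcomp (bard n) (bard n.+1)) (tpure e m x : (bar n.+2)\_g) =
  gapp (bard n) (tpure e (gapp (bard n) m) x : (bar n.+1)\_g)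
    - (-1) ^+ n *: gapp (actr (bar n)) (tpure e (gapp (bard n) m) x).
Proof.
rewrite bcompE [bard n.+1]/= bhomDE bhomZE actr_homE tmapE gapp_D gapp_Z bhom_r.
by rewrite exprS mulN1r scaleNr.
Qed.

Let bard_ind n :
  (forall X Y Z (f1 : mor X Z) (f2 : mor Z Y) (g : mor X Y) (e : f2 \oc f1 = g)
     (m : (bar n.+1)\_f1) (x : A\_f2),
   gapp (bard n) (tpure e (gapp (bard n) m) x : (bar n.+1)\_g) =
   (-1) ^+ n *: gapp (actr (bar n)) (tpure e (gapp (bard n) m) x)) ->
  bcomp (bard n) (bard n.+1) = 0.
Proof.
move=> H; apply: bhom_eq => X Y f x; rewrite bhom0E.
elim/tensor_ind: x => [|u v IHu IHv|Z g1 g2 e m b]; first by rewrite !gapp_0.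
  by rewrite !gapp_D IHu IHv addr0.
by rewrite bard2E H subrr.
Qed.

Lemma bard_bard n : bcomp (bard n) (bard n.+1) = 0.
Proof.
elim: n => [|n IHn]; apply: bard_ind => X Y Z f1 f2 g e m x.
  by rewrite expr0 scale1r; apply: actr_homE.
by rewrite bardSE -(bcompE (bard n)) IHn bhom0E tpure0l add0r.
Qed.

Section Cohomology.
Variable M : bimodule A.

Definition cochain (n : nat) : Type := bhom (bar n.+1) M.
HB.instance Definition _ n := GRing.Lmodule.on (cochain n).

Identity Coercion bhom_of_cochain : cochain >-> bhom.

Definition codiff n (phi : cochain n) : cochain n.+1 := bcomp phi (bard n.+1).

Fact codiff_linear n : linear (@codiff n).
Proof.
move=> c phi psi; apply: bhom_eq => X Y f x.
by rewrite bcompE !bhomDE !bhomZE !bcompE.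
Qed.
HB.instance Definition _ n :=
  GRing.isLinear.Build k (cochain n) (cochain n.+1) _ (@codiff n) (@codiff_linear n).

Lemma codiff_codiff n (phi : cochain n) : codiff (codiff phi) = 0.
Proof.
apply: bhom_eq => X Y f x; rewrite !bcompE -(bcompE (bard n.+1)) bard_bard.
exact: linear0.
Qed.

Definition cocycle_pred n : {pred cochain n} := fun phi => codiff phi == 0.
Fact cocycle_closed n : submod_closed (@cocycle_pred n).
Proof.
split=> [|c u v /eqP Zu /eqP Zv]; apply/eqP; first exact: linear0.
by rewrite codiff_linear Zu Zv scaler0 addr0.
Qed.
HB.instance Definition _ n :=
  GRing.isSubmodClosed.Build k (cochain n) (@cocycle_pred n) (@cocycle_closed n).

Record cocycle n := Cocycle {
  cocycle_val :> cochain n;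
  cocycleP : cocycle_val \in @cocycle_pred n }.
HB.instance Definition _ n := [isSub for @cocycle_val n].
HB.instance Definition _ n := [Choice of cocycle n by <:].
HB.instance Definition _ n := [SubChoice_isSubLmodule of cocycle n by <:].

Definition coboundary_pred n : {pred cocycle n} :=
  match n return pred (cocycle n) with
  | 0 => fun z => z == 0
  | n'.+1 => fun z => `[< exists c : cochain n', cocycle_val z = codiff c >]
  end.
Fact coboundary_closed n : submod_closed (@coboundary_pred n).
Proof.
case: n => [|n]; split=> [|c u v]; rewrite -!topredE /=.
- by rewrite eqxx.
- by move=> /eqP-> /eqP->; rewrite scaler0 addr0.
- by apply/asboolP; exists 0; rewrite linear0.
- move=> /asboolP[x ux] /asboolP[y vy]; apply/asboolP; exists (c *: x + y).
  by rewrite codiff_linear -ux -vy.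
Qed.
HB.instance Definition _ n :=
  GRing.isSubmodClosed.Build k (cocycle n) (@coboundary_pred n) (@coboundary_closed n).

Definition HH n : lmodType k := quotmod (@coboundary_pred n).
Definition HHclass n (z : cocycle n) : HH n := qclass (@coboundary_pred n) z.

Definition inv_pred : {pred dprod (fun X : C => M\_(idm X))} := fun m =>
  `[< forall (X Y : C) (f : mor X Y) (x : A\_f)
        (el : idm Y \oc f = f) (er : f \oc idm X = f),
      gapp (actl M) (tpure el x (m Y)) =
      zeta a f *: gapp (actr M) (tpure er (m X) x) >].
Fact inv_closed : submod_closed inv_pred.
Proof.
split=> [|c u v /asboolP Iu /asboolP Iv]; apply/asboolP => X Y f x el er.
  by rewrite tpure0l tpure0r !gapp_0 scaler0.
have E Z : (c *: u + v) Z = c *: u Z + v Z by [].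
rewrite !E tpureDl tpureDr tpureZl tpureZr !gapp_D !gapp_Z.
rewrite (Iu _ _ _ _ _ er) (Iv _ _ _ _ _ er).
by rewrite scalerDr !scalerA mulrC.
Qed.
HB.instance Definition _ := GRing.isSubmodClosed.Build k _ inv_pred inv_closed.

(* The formal sums over the objects need not be finite. *)
Record invariants := Invariants {
  inv_val :> dprod (fun X : C => M\_(idm X));
  invP : inv_val \in inv_pred }.
HB.instance Definition _ := [isSub for inv_val].
HB.instance Definition _ := [Choice of invariants by <:].
HB.instance Definition _ := [SubChoice_isSubLmodule of invariants by <:].

End Cohomology.

Definition center_pred : {pred dprod (fun X : C => A\_(idm X))} := fun z =>
  `[< forall (X Y : C) (f : mor X Y) (x : A\_f)
        (el : idm Y \oc f = f) (er : f \oc idm X = f),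
      gapp (amul A) (tpure el x (z Y)) =
      zeta a f *: gapp (amul A) (tpure er (z X) x) >].
Fact center_closed : submod_closed center_pred.
Proof. exact: (inv_closed regular). Qed.
HB.instance Definition _ := GRing.isSubmodClosed.Build k _ center_pred center_closed.

Record gcenter := Center {
  center_val :> dprod (fun X : C => A\_(idm X));
  centerP : center_val \in center_pred }.
HB.instance Definition _ := [isSub for center_val].
HB.instance Definition _ := [Choice of gcenter by <:].
HB.instance Definition _ := [SubChoice_isSubLmodule of gcenter by <:].

End Bimodules.

(* Main.v *)
(* A bimodule map [phi] out of [A (x) A] is determined by the elements
   [phi (1_X (x) 1_X)], since [(x . (1 (x) 1)) . y] is a unit multiple of
   [x (x) y]; the cocycle equation at [1 (x) x (x) 1] says that these elements
   are invariant.  Conversely, an invariant [m] defines the cocycle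
   [x (x) y |-> alpha(|x|, Id, Id)^-1 (x m) y]. *)
From HB Require Import structures.
Require Import Defs.
From mathcomp Require Import all_boot all_algebra.
From mathcomp Require Import ring boolp.

Set Implicit Arguments.
Unset Strict Implicit.
Unset Printing Implicit Defensive.

Import GRing.Theory.
Local Open Scope ring_scope.

(** * Consequences of the cocycle condition at identity morphisms *)

Section Associator.
Variables (k : comPzRingType) (C : category) (a : grading k C).

Lemma ascVK X Y Z W (f1 : mor X Y) (f2 : mor Y Z) (f3 : @mor C Z W) :
  ascV a f1 f2 f3 * asc a f1 f2 f3 = 1.
Proof. by rewrite mulrC ascK. Qed.

(** Cocycle condition at (f, Id, Id, g): [asc a f (idm Y) g] occurs once on one side and twice on
    the other, and one copy cancels. *)
Lemma asc_idmid X Y Z (f : @mor C X Y) (g : mor Y Z) :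
  asc a f (idm Y) g = asc a f (idm Y) (idm Y) * asc a (idm Y) (idm Y) g.
Proof.
have := asc_cocycleM a f (idm Y) (idm Y) g; rewrite compm1 compm1 comp1m.
by rewrite mulrAC mulrC => /ascI.
Qed.

(** Cocycle condition at (Id, Id, f, Id): after cancelling alpha(Id, Id, f), it reads q * q = q for
    the unit q in question. *)
Lemma asc_idsides X Y (f : @mor C X Y) : asc a (idm X) f (idm Y) = 1.
Proof.
have := asc_cocycleM a (idm X) (idm X) f (idm Y).
by rewrite compm1 comp1m compm1 -mulrA => /ascI; rewrite -[RHS]mulr1 => /ascI.
Qed.

(** Cocycle condition at (f, g, Id, Id), with one factor alpha(f, g, Id) cancelled. *)
Lemma asc_runit X Y Z (f : @mor C X Y) (g : mor Y Z) :
  asc a (g \oc f) (idm Z) (idm Z) =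
  asc a f g (idm Z) * asc a g (idm Z) (idm Z).
Proof.
have := asc_cocycleM a f g (idm Z) (idm Z); rewrite !comp1m -mulrA.
by move=> /ascI.
Qed.

Lemma ascV_eq X Y Z W (f1 : mor X Y) (f2 : mor Y Z) (f3 : @mor C Z W) c :
  asc a f1 f2 f3 * c = 1 -> ascV a f1 f2 f3 = c.
Proof. by rewrite -(ascK a f1 f2 f3) => /ascI. Qed.

Lemma ascV_runit X Y Z (f : @mor C X Y) (g : mor Y Z) :
  ascV a (g \oc f) (idm Z) (idm Z) =
  ascV a f g (idm Z) * ascV a g (idm Z) (idm Z).
Proof. by apply: ascV_eq; rewrite asc_runit mulrACA !ascK mulr1. Qed.

End Associator.

(** * Degree-zero cocycles and their values at 1 (x) 1 *)

Section ZerothCohomology.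
Variables (k : comPzRingType) (C : category) (a : grading k C).
Variables (A : galgebra a) (M : bimodule A).

Let one2 (X : C) : (bar A 1)\_(idm X) :=
  tpure (comp1m (idm X)) (aone A X) (aone A X).

(** No scalar survives: the inverse associator in the left action on the tensor product cancels the
    right unitor of x 1 exactly. *)
Lemma actl_one2 X Y (f : @mor C X Y) (e : idm Y \oc f = f) (x : A\_f) :
  gapp (actl (bar A 1)) (tpure e x (one2 Y)) = tpure e x (aone A Y).
Proof.
rewrite (tactlE (N := regular A) (comp1m (idm Y)) e e e).
by rewrite amul1r tpureZl scalerA /runit ascVK; exact: scale1r.
Qed.

(** The action gives alpha(f1, Id, f2) and the left unitor of 1 y gives alpha(Id, Id, f2)^-1;
    [asc_idmid] reduces their product to a scalar independent of y. *)
Lemma actr_pure_one X Y Z (f1 : @mor C X Z) (f2 : mor Z Y) (g : mor X Y)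
    (e1 : idm Z \oc f1 = f1) (e : f2 \oc f1 = g) (x : A\_f1) (y : A\_f2) :
  gapp (actr (bar A 1)) (tpure e (tpure e1 x (aone A Z) : (bar A 1)\_f1) y) =
  asc a f1 (idm Z) (idm Z) *: (tpure e x y : (bar A 1)\_g).
Proof.
rewrite (tactrE (N := regular A) e1 e (compm1 f2) e).
by rewrite amul1l tpureZr scalerA /lunit asc_idmid -mulrA ascK mulr1.
Qed.

(** Since x (x) y is a unit multiple of (x . (1 (x) 1)) . y, bilinearity over [A] pulls both actions
    out of [phi]. This also dictates the inverse construction [inv_bil]. *)
Lemma cochain0E (phi : cochain M 0) X Y Z (f1 : @mor C X Z) (f2 : mor Z Y)
    (g : mor X Y) (e : f2 \oc f1 = g) (x : A\_f1) (y : A\_f2) :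
  gapp phi (tpure e x y) = ascV a f1 (idm Z) (idm Z) *:
    gapp (actr M) (tpure e
      (gapp (actl M) (tpure (comp1m f1) x (gapp phi (one2 Z)))) y).
Proof.
rewrite -bhom_l actl_one2 -bhom_r actr_pure_one gapp_Z scalerA ascVK.
by rewrite scale1r.
Qed.

Lemma cochain0_eq (phi psi : cochain M 0) :
  (forall X, gapp phi (one2 X) = gapp psi (one2 X)) -> phi = psi.
Proof.
move=> eq1; apply: bhom_eq => X Y f u.
elim/tensor_ind: u => [|u v IHu IHv|Z f1 f2 e x y].
- by rewrite !gapp_0.
- by rewrite !gapp_D IHu IHv.
by rewrite [LHS]cochain0E [RHS]cochain0E eq1.
Qed.

Lemma codiff0E (phi : cochain M 0) X Y Z W (f1 : @mor C X Y) (f2 : mor Y Z)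
    (f3 : mor Z W) f12 f23 f (e12 : f2 \oc f1 = f12) (e23 : f3 \oc f2 = f23)
    (el : f3 \oc f12 = f) (er : f23 \oc f1 = f)
    (x : A\_f1) (y : A\_f2) (z : A\_f3) :
  gapp (codiff phi) (tpure el (tpure e12 x y : (bar A 1)\_f12) z) =
  gapp phi (tpure el (gapp (amul A) (tpure e12 x y)) z)
    - asc a f1 f2 f3 *:
      gapp phi (tpure er x (gapp (amul A) (tpure e23 y z))).
Proof.
rewrite /codiff bcompE bardSE gapp_D gapp_Z expr1 scaleN1r.
rewrite (tactrE (N := regular A) e12 el e23 er).
by rewrite gapp_Z.
Qed.

Definition cocycle_unit (phi : cochain M 0) : dprod (fun X : C => M\_(idm X)) :=
  fun X => gapp phi (one2 X).

Lemma cocycle_unit_inv (phi : cocycle M 0) : cocycle_unit phi \in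
  @inv_pred _ _ _ _ M.
Proof.
apply/asboolP => X Y f x el er; rewrite /cocycle_unit.
rewrite -bhom_l actl_one2 -bhom_r.
(* The scalar that appears is alpha(Id, Id, Id), equal to 1 by [asc_idsides]. *)
have -> : gapp (actr (bar A 1)) (tpure er (one2 X) x) = tpure er (aone A X) x.
  by rewrite actr_pure_one asc_idsides scale1r.
have /eqP/(congr1 (fun psi : cochain M 1 => gapp psi
    (tpure el (tpure er (aone A X) x : (bar A 1)\_f) (aone A Y)))) := cocycleP phi.
rewrite (codiff0E phi er el el er) bhom0E amul1l amul1r.
rewrite tpureZl tpureZr !gapp_Z asc_idsides scale1r => /eqP; rewrite subr_eq0.
(* Scaling by alpha(Id, Id, f) clears the left unitor; with the right unitor on the other side it
   forms [zeta]. *)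
move=> /eqP /(congr1 ( *:%R (asc a (idm X) (idm X) f))).
by rewrite !scalerA ascK scale1r.
Qed.

Definition cocycle_inv (phi : cocycle M 0) : invariants M :=
  Invariants (cocycle_unit_inv phi).

(** * The cocycle attached to an invariant *)

Section CocycleOfInvariant.
Variable m : invariants M.

Definition inv_bil X Y (g : mor X Y) Z (f1 : mor X Z) (f2 : mor Z Y)
    (e : f2 \oc f1 = g) (x : A\_f1) (y : A\_f2) : M\_g :=
  ascV a f1 (idm Z) (idm Z) *:
    gapp (actr M) (tpure e (gapp (actl M) (tpure (comp1m f1) x (inv_val m Z))) y).

Lemma inv_bilin X Y (g : mor X Y) : bilin (@inv_bil X Y g).
Proof.
move=> Z f1 f2 e; split=> [x c y y'|y c x x']; rewrite /inv_bil.
  by rewrite tpureDr tpureZr linearP scalerDr !scalerA mulrC.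
rewrite tpureDl tpureZl linearP tpureDl tpureZl linearP scalerDr !scalerA.
by rewrite mulrC.
Qed.

Definition inv_gmap : gmap (tensor A A) M := glift inv_bilin.

Lemma inv_gmapE X Y Z (f1 : mor X Z) (f2 : mor Z Y) (g : mor X Y)
    (e : f2 \oc f1 = g) (x : A\_f1) (y : A\_f2) :
  gapp inv_gmap (tpure e x y) = ascV a f1 (idm Z) (idm Z) *:
    gapp (actr M) (tpure e (gapp (actl M) (tpure (comp1m f1) x (inv_val m Z))) y).
Proof. exact: glift_pure. Qed.

(** For the left action, [ascV_runit] splits the normalizing scalar so that the associators from
    [actlA] and [actlrA] cancel. For the right action, [actrA] alone matches the scalars. *)
Lemma inv_bhom :
  (inv_gmap : gmap (bar A 1) M) \in @bhom_pred _ _ _ _ (bar A 1) M.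
Proof.
apply/asboolP; split=> X Y Z f1 f2 g e.
  move=> x u; elim/tensor_ind: u => [|u v IHu IHv|V g1 g2 e1 y z].
  - by rewrite !(tpure0r, gapp_0).
  - by rewrite !(tpureDr, gapp_D) IHu IHv.
  have E : g2 \oc (g1 \oc f1) = g by rewrite Defs.compA e1.
  rewrite (tactlE (N := regular A) e1 e erefl E).
  rewrite gapp_Z !inv_gmapE.
  rewrite (actlA erefl (comp1m g1) _ erefl) tpureZl gapp_Z.
  rewrite (actlrA erefl e1 E e) tpureZr gapp_Z !scalerA ascV_runit.
  congr (_ *: _).
  transitivity (asc a f1 g1 g2 * ascV a f1 g1 g2 *
    (asc a f1 g1 (idm V) * ascV a f1 g1 (idm V)) *
    ascV a g1 (idm V) (idm V)); first by ring.
  by rewrite !ascK !mul1r.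
move=> u z; elim/tensor_ind: u => [|u v IHu IHv|V g1 g2 e1 x y].
- by rewrite !(tpure0l, gapp_0).
- by rewrite !(tpureDl, gapp_D) IHu IHv.
have E : (f2 \oc g2) \oc g1 = g by rewrite -Defs.compA e1.
rewrite (tactrE (N := regular A) e1 e erefl E).
rewrite gapp_Z !inv_gmapE tpureZl gapp_Z (actrA e1 erefl e E) !scalerA.
by rewrite mulrC.
Qed.

Definition inv_cochain : cochain M 0 := BHom inv_bhom.

Lemma inv_cochainP : inv_cochain \in @cocycle_pred _ _ _ _ M 0.
Proof.
apply/eqP/bhom_eq => X Y f u; rewrite bhom0E.
elim/tensor_ind: u => [|u v IHu IHv|W f12 f3 el u z].
- by rewrite !gapp_0.
- by rewrite !gapp_D IHu IHv addr0.
elim/tensor_ind: u => [|u v IHu IHv|Z f1 f2 e12 x y].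
- by rewrite tpure0l gapp_0.
- by rewrite tpureDl gapp_D IHu IHv addr0.
have er : (f3 \oc f2) \oc f1 = f by rewrite -Defs.compA e12.
rewrite (codiff0E _ e12 erefl el er) !inv_gmapE; apply/eqP.
rewrite subr_eq0; apply/eqP.
rewrite (actlA e12 (comp1m f2) _ e12) tpureZl gapp_Z.
(* Invariance moves m across y at the cost of [zeta]. Both sides can then be brought to the form (x
   (m y)) z. *)
have /asboolP/(_ _ _ f2 y (comp1m f2) (compm1 f2)) -> := invP m.
rewrite tpureZr gapp_Z tpureZl gapp_Z [RHS]scalerA [_ * ascV _ _ _ _]mulrC.
(* Used backwards, [actrA] absorbs the associator of the codifferential, leaving only scalars with
   an identity argument to compare. *)
rewrite -[RHS]scalerA -(actrA e12 erefl el er).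
rewrite (actlrA (comp1m f1) (compm1 f2) e12 e12) tpureZl gapp_Z !scalerA.
congr (_ *: _); rewrite -e12 ascV_runit asc_idmid /zeta.
transitivity ((asc a f1 f2 (idm W) * ascV a f1 f2 (idm W)) *
  (asc a f2 (idm W) (idm W) * ascV a f2 (idm W) (idm W)) *
  asc a (idm Z) (idm Z) f2); first by ring.
by rewrite !ascK mulrA ascVK !mul1r.
Qed.

Definition inv_cocycle : cocycle M 0 := Cocycle inv_cochainP.

Lemma inv_cocycle_unit X : gapp inv_cocycle (one2 X) = inv_val m X.
Proof.
rewrite inv_gmapE actl1 tpureZl gapp_Z actr1 !scalerA /lunit /runit.
rewrite asc_idsides mulr1.
by rewrite (ascV_eq (c := 1)) ?asc_idsides ?mulr1 ?scale1r.
Qed.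

End CocycleOfInvariant.

(** In degree 0 the only coboundary is 0, so each class has a single representative. Hence [HH0_inv]
    may be defined through [qrepr] and still be linear. *)
Lemma qrepr_HHclass0 (phi : cocycle M 0) : qrepr (HHclass phi) = phi.
Proof.
have /qclass_eq := qreprK (HHclass phi).
by rewrite -topredE /= subr_eq0 => /eqP.
Qed.

Definition HH0_inv (q : HH M 0) : invariants M := cocycle_inv (qrepr q).

Lemma HH0_inv_linear : linear HH0_inv.
Proof.
move=> c u v; rewrite -[u]qreprK -[v]qreprK -qclass_linear; apply: val_inj.
by rewrite /HH0_inv !qrepr_HHclass0.
Qed.
HB.instance Definition _ :=
  GRing.isLinear.Build k (HH M 0) (invariants M) _ HH0_inv HH0_inv_linear.

Lemma HH0_invE (phi : cocycle M 0) X :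
  inv_val (HH0_inv (HHclass phi)) X = gapp phi (one2 X).
Proof. by rewrite /HH0_inv qrepr_HHclass0. Qed.

Lemma HH0_inv_bij : bijective HH0_inv.
Proof.
exists (fun m => HHclass (inv_cocycle m)) => [q|m].
  rewrite -[q in RHS]qreprK; congr HHclass; apply: val_inj.
  (* Both cocycles take the same values at 1 (x) 1, which determine them. *)
  by apply: cochain0_eq => X; rewrite inv_cocycle_unit.
apply: val_inj; apply: functional_extensionality_dep => X.
by rewrite [LHS]HH0_invE inv_cocycle_unit.
Qed.

End ZerothCohomology.

(** * The case M = A: the graded center *)

Section Center.
Variables (k : comPzRingType) (C : category) (a : grading k C).
Variable A : galgebra a.

(* [center_pred] is [inv_pred (regular A)] up to conversion. *)
Definition HH0_center (q : HH (regular A) 0) : gcenter A :=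
  @Center k C a A (inv_val (HH0_inv q)) (invP (HH0_inv q)).

Lemma HH0_center_linear : linear HH0_center.
Proof.
move=> c u v; apply: val_inj.
exact: (congr1 (@inv_val _ _ _ _ _) (HH0_inv_linear c u v)).
Qed.
HB.instance Definition _ :=
  GRing.isLinear.Build k (HH (regular A) 0) (gcenter A) _
    HH0_center HH0_center_linear.

Lemma HH0_center_bij : bijective HH0_center.
Proof.
have [G HK GK] := HH0_inv_bij (regular A).
(* The inverse [G] for the regular bimodule, after repackaging a central element as an invariant. *)
exists (fun z : gcenter A => G (@Invariants k C a A (regular A) z (centerP z))).
  move=> q; rewrite -[RHS]HK; congr G; exact: val_inj.
move=> z; apply: val_inj; exact: (congr1 (@inv_val _ _ _ _ _) (GK _)).
Qed.

End Center.

Theorem corollary4p7 (k : comPzRingType) (C : category) (a : grading k C)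
    (A : galgebra a) (M : bimodule A) :
  (exists F : {linear HH M 0 -> invariants M},
     bijective F /\
     forall (phi : cocycle M 0) (X : C),
       inv_val (F (HHclass phi)) X =
         gapp phi (tpure (comp1m (idm X)) (aone A X) (aone A X))) /\
  (exists F : {linear HH (regular A) 0 -> gcenter A},
     bijective F /\
     forall (phi : cocycle (regular A) 0) (X : C),
       center_val (F (HHclass phi)) X =
         gapp phi (tpure (comp1m (idm X)) (aone A X) (aone A X))).
Proof.
split; [exists (@HH0_inv k C a A M) | exists (@HH0_center k C a A)]; split.
- exact: HH0_inv_bij.
- exact: HH0_invE.
- exact: HH0_center_bij.
- exact: HH0_invE.
Qed.
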